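(* Let $K$ be a kernel such that $K(t,\cdot)\in L_2([0,t])$ for every $t\in[0,1]$ and $\sup_{t\in[0,1]}\int_0^t K(t,s)^2\,ds<\infty$. Then the functional $f:L_2([0,1])\to\mathbb{R}$, $f(x)=\sup_{t\in[0,1]}\left(\int_0^t (K(t,s)-x(s))^2\,ds\right)^{1/2}$, attains its minimal value on $L_2([0,1])$; that is, there is $x^*\in L_2([0,1])$ with $f(x^* )=\inf_{x\in L_2([0,1])}f(x)$.
   Context: $K=K(t,s)$ is a real-valued kernel, $t,s\in[0,1]$, arbitrary apart from the stated condition. $L_2([0,1])$ is the real Hilbert space of square integrable functions on $[0,1]$ with respect to Lebesgue measure. *)

(* Defs.v *)
From HB Require Import structures.
From mathcomp Require Import all_boot all_order all_algebra.
From mathcomp Require Import all_classical all_reals all_analysis.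

Set Implicit Arguments.
Unset Strict Implicit.
Unset Printing Implicit Defensive.

Import Order.TTheory GRing.Theory Num.Theory.
Import numFieldNormedType.Exports.

Local Open Scope classical_set_scope.
Local Open Scope ring_scope.

(* [lebesgue_measure] lives on the Borel sigma-algebra; the completed measure is
   used so that "measurable" means Lebesgue measurable.  The carrier of its
   domain is convertible to [R], so a function [R -> R] can be passed as it is. *)
Notation leb R := (@completed_lebesgue_measure R).

Lemma measurable_leb_itv (R : realType) (i : interval R) :
  (wlength (@idfun R))^*%mu.-cara.-measurable [set` i].
Proof. by apply: sub_caratheodory; exact: measurable_itv. Qed.

(* Restricting the measure makes values outside `[a, b] irrelevant up to
   almost-everywhere equality, so that this is L_2([a, b]), as a type of
   equivalence classes. *)
Definition L2 (R : realType) (a b : R) : Type :=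
  LspaceType2 (mrestr (leb R) (measurable_leb_itv `[a, b])).

(* The function [g] is square integrable on `[a, b].  [g \_ `[a, b]] is [g]
   extended by 0 outside `[a, b], so no measurability of [g] is required
   there. *)
Definition square_integrable (R : realType) (a b : R) (g : R -> R) : Prop :=
  g \_ `[a, b] \in Lfun (leb R) 2%:E.

(* The value at a class [x] is computed on the representative given by the
   coercion of classes to functions.  Values are in [\bar R] because the real
   [sup] of an unbounded set has a default value. *)
Definition sup_dist (R : realType) (K : R -> R -> R) (x : L2 (0 : R) 1) : \bar R :=
  ereal_sup [set sqrte (\int[leb R]_(s in `[0%R, t]) ((K t s - x s) ^+ 2)%:E)%E
            | t in `[0%R, 1%R]].

(* Main.v *)
From HB Require Import structures.
Require Import Defs.
From mathcomp Require Import all_boot all_order all_algebra.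
From mathcomp Require Import all_classical all_reals all_analysis.
From mathcomp Require Import measurable_realfun ring lra.

Set Implicit Arguments.
Unset Strict Implicit.
Unset Printing Implicit Defensive.

Import Order.TTheory GRing.Theory Num.Theory.
Import numFieldNormedType.Exports.

Local Open Scope classical_set_scope.
Local Open Scope ring_scope.

(** The squared functional F(x) = sup_t int_0^t (K(t,s) - x(s))^2 ds is midpoint
    convex, lower semicontinuous and coercive, since the term t = 1 is the full
    squared L_2 distance from x to K(1,.); a minimizer then exists by the usual
    Hilbert space argument.  Weak compactness is avoided as follows.

    Let m = inf F and let C_n be the set of the x with F(x) <= m + 1/(n+1).
    These sets are nonempty, nested and stable under midpoints.  Write N(x) for
    the squared distance to K(1,.); it is bounded on C_0 because N <= F.  As in
    the projection theorem, points of C_n that nearly minimize N are close to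
    each other: the parallelogram identity ([sqdist_parallelogram]) expresses
    the squared distance of x and y as 2 (N x + N y - 2 N ((x + y) / 2)), and
    ([nested_midpoint_min]) this can be made as small as desired along a
    sequence y_k in C_k.  When the squared distances of consecutive terms decay
    geometrically, y_k converges almost everywhere ([ae_cvg_sqdist]), and
    Fatou's lemma applied to each t separately ([sqdist_ae_lim]) shows that the
    limit z satisfies F(z) <= m ([worst_attains_min]).

    The argument is carried out with functions on a general measure space; the
    last step moves between functions and classes ([Lspace2_class]) and between
    F and its square root ([ereal_sup_sqrte]). *)

(** * Nested midpoint-stable sets *)

(** The infima of [N] over the sets [C n] increase to a limit [l].  Once
    [inf N] over [C n] is close to [l], two points of [C n] with [N] close to
    [l] have a midpoint at which [N] cannot be much smaller than [l], so the
    midpoint defect is small.  With [N] a squared distance, the defect is half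
    of the squared distance of the two points. *)
Lemma nested_midpoint_min (R : realType) (T : Type) (C : nat -> set T)
    (N : T -> R) (mid : T -> T -> T) (B : R) (eps : nat -> R) :
  (forall n, C n !=set0) -> (forall m n, (m <= n)%N -> C n `<=` C m) ->
  (forall n x y, C n x -> C n y -> C n (mid x y)) ->
  (forall x, C 0%N x -> 0 <= N x <= B) ->
  (forall k, 0 < eps k) ->
  exists y : nat -> T, forall k, C k (y k) /\
    N (y k) + N (y k.+1) - 2 * N (mid (y k) (y k.+1)) <= eps k.
Proof.
move=> C0 Cnd Cmid NB eps0.
pose d n := inf (N @` C n).
have Cle n x : C n x -> 0 <= N x <= B by move=> /(Cnd 0%N n (leq0n _)); exact: NB.
have hinf n : has_inf (N @` C n).
  split; first by have [x Cx] := C0 n; exists (N x), x.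
  by exists 0 => _ [x /Cle/andP[? _] <-].
have dN n x : C n x -> d n <= N x.
  by move=> Cx; apply: ge_inf; [exact: (hinf n).2|exists x].
have dnd : nondecreasing_seq d.
  move=> m n mn; apply: lb_le_inf; first exact: (hinf n).1.
  by move=> _ [x Cx <-]; apply: dN; exact: Cnd Cx.
have dB n : d n <= B.
  by have [x Cx] := C0 n; rewrite (le_trans (dN _ _ Cx))//; case/andP: (Cle _ _ Cx).
have hsup : has_sup (range d).
  by split; [exists (d 0%N), 0%N | exists B => _ [n _ <-]].
pose l := sup (range d).
have dl n : d n <= l by apply: ub_le_sup; [exact: hsup.2|exists n].
(* The k-th point occurs in the k-th and in the (k-1)-st inequality. *)
pose tol k := Num.min (eps k) (eps k.-1) / 4.
have tol0 k : 0 < tol k by rewrite divr_gt0// lt_min !eps0.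
have /choice[n0 n0P] k : exists n, l - tol k < d n.
  have [_ [n _ <-] ?] := sup_adherent (tol0 k) hsup.
  by exists n.
(* n is monotone, k <= n k and n0 k <= n k; so n k satisfies the estimate
   chosen for n0 k, and the next point lies in C (n k) as well. *)
pose n k := (k + \sum_(i < k.+1) n0 i)%N.
have nS k : (n k <= n k.+1)%N.
  by rewrite /n (big_ord_recr k.+1)/= leq_add// leq_addr.
have n0n k : (n0 k <= n k)%N.
  by rewrite /n big_ord_recr/= addnA leq_addl.
have /choice[y yP] k : exists y, C (n k) y /\ N y < d (n k) + tol k.
  by have [_ [y Cy <-] ?] := inf_adherent (tol0 k) (hinf (n k)); exists y.
exists y => k; have [Cy Ny] := yP k; split.
  by apply: Cnd Cy; exact: leq_addr.
have [CyS NyS] := yP k.+1.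
have Cm : C (n k) (mid (y k) (y k.+1)).
  by apply: Cmid => //; exact: Cnd CyS.
have := dN _ _ Cm; have := dnd _ _ (n0n k); have := n0P k.
have := dl (n k); have := dl (n k.+1).
have : tol k <= eps k / 4 by rewrite ler_pM2r ?invr_gt0// ge_min lexx.
have : tol k.+1 <= eps k / 4 by rewrite ler_pM2r ?invr_gt0// ge_min lexx orbT.
lra.
Qed.

(** * Squared L_2 distance *)

Section sqdist.
Context d (T : measurableType d) (R : realType).
Variable mu : {measure set T -> \bar R}.
Implicit Types (D : set T) (f g h : T -> R).
Local Open Scope ereal_scope.

Definition sqdist D f g := \int[mu]_(s in D) ((f s - g s) ^+ 2)%:E.

Lemma sqdist_ge0 D f g : 0 <= sqdist D f g.
Proof. by apply: integral_ge0 => s _; rewrite lee_fin sqr_ge0. Qed.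

Lemma measurable_sqdiff D f g :
  measurable_fun D f -> measurable_fun D g ->
  measurable_fun D (fun s => ((f s - g s) ^+ 2)%:E).
Proof.
move=> mf mg; apply/measurable_EFinP.
by apply: measurable_funX; exact: measurable_funB.
Qed.

Definition midfun f g : T -> R := fun s => ((f s + g s) / 2)%R.

Lemma measurable_midfun D f g :
  measurable_fun D f -> measurable_fun D g -> measurable_fun D (midfun f g).
Proof.
by move=> mf mg; apply: measurable_funM => //; exact: measurable_funD.
Qed.

Lemma sqdist_parallelogram D h f g : measurable D ->
  measurable_fun D h -> measurable_fun D f -> measurable_fun D g ->
  sqdist D f g + 4%:E * sqdist D h (midfun f g) =
  2%:E * (sqdist D h f + sqdist D h g).
Proof.
move=> mD mh mf mg; rewrite /sqdist.
have p a b s : D s -> 0%:E <= ((a s - b s) ^+ 2 : R)%:E by rewrite lee_fin sqr_ge0.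
have m := measurable_sqdiff; have mm := measurable_midfun mf mg.
rewrite -ge0_integralZl//; [|exact: m|exact: p].
rewrite -ge0_integralD//; [|exact: p|exact: m|by move=> s Ds; rewrite mule_ge0//; exact: p
  |by apply: measurable_funeM; exact: m].
rewrite -ge0_integralD//; [|exact: p|exact: m|exact: p|exact: m].
rewrite -ge0_integralZl//; [|by apply: emeasurable_funD; exact: m|
  by move=> s Ds; rewrite adde_ge0//; exact: p].
apply: eq_integral => s _; rewrite -!EFinM -!EFinD; congr EFin.
by rewrite /midfun; field.
Qed.

(** The constant 2 comes from dropping the midpoint term of the parallelogram
    identity. *)
Lemma sqdist_triangle D h f g : measurable D ->
  measurable_fun D h -> measurable_fun D f -> measurable_fun D g ->
  sqdist D f g <= 2%:E * (sqdist D h f + sqdist D h g).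
Proof.
move=> mD mh mf mg; rewrite -sqdist_parallelogram// leeDl//.
by rewrite mule_ge0// sqdist_ge0.
Qed.

(** Midpoint convexity of squared balls, again by the parallelogram identity. *)
Lemma sqdist_mid_le D h f g c : measurable D ->
  measurable_fun D h -> measurable_fun D f -> measurable_fun D g ->
  sqdist D h f <= c -> sqdist D h g <= c -> sqdist D h (midfun f g) <= c.
Proof.
move=> mD mh mf mg fc gc.
rewrite -(@lee_pmul2l _ 4%:E)//.
apply: (@le_trans _ _ (2%:E * (sqdist D h f + sqdist D h g))).
  by rewrite -sqdist_parallelogram// leeDr// sqdist_ge0.
apply: (@le_trans _ _ (2%:E * (c + c))); first by rewrite lee_pmul2l// leeD.
by rewrite !mule_natl /= !addeA.
Qed.

Lemma sqdist_subset D E h f : measurable D -> measurable E -> D `<=` E ->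
  measurable_fun E h -> measurable_fun E f -> sqdist D h f <= sqdist E h f.
Proof.
move=> mD mE DE mh mf; apply: ge0_subset_integral => //.
  exact: measurable_sqdiff.
by move=> s _; rewrite lee_fin sqr_ge0.
Qed.

Lemma sqdist_ae_eq D h f g : measurable D -> measurable_fun D h ->
  measurable_fun D f -> measurable_fun D g -> f = g %[ae mu in D] ->
  sqdist D h f = sqdist D h g.
Proof.
move=> mD mh mf mg fg; apply: ge0_ae_eq_integral => //.
- exact: measurable_sqdiff.
- exact: measurable_sqdiff.
- by move=> s _; rewrite lee_fin sqr_ge0.
- by move=> s _; rewrite lee_fin sqr_ge0.
- by apply: filterS fg => s fgs /fgs ->.
Qed.

End sqdist.

(** * Almost everywhere convergence *)

(** The increments are at most [sqrt M / 2 ^ k], hence absolutely summable. *)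
Lemma cvg_quarter_increments (R : realType) (u : nat -> R) (M : R) :
  (forall k, 4 ^+ k * (u k - u k.+1) ^+ 2 <= M)%R -> cvgn u.
Proof.
move=> uM.
have M0 : (0 <= M)%R by apply: le_trans (uM 0%N); rewrite mulr_ge0// sqr_ge0.
have geo0 k : (0 <= geometric (Num.sqrt M) 2^-1 k)%R.
  by rewrite /geometric/= mulr_ge0// exprn_ge0// invr_ge0.
have inc k : (`|telescope u k| <= geometric (Num.sqrt M) (2^-1) k)%R.
  rewrite -(@ler_pXn2r _ 2)// ?nnegrE// /geometric/= /telescope distrC.
  rewrite exprMn sqr_sqrtr// -exprM mulnC exprM exprVn real_normK ?num_real//.
  rewrite (_ : (2 ^+ 2 = 4 :> R)%R); last by rewrite -natrX.
  by rewrite exprVn ler_pdivlMr ?exprn_gt0// mulrC.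
have /normed_cvg cvgu : cvgn [normed series (telescope u)].
  apply: (@series_le_cvg _ _ (geometric (Num.sqrt M) (2^-1))%R) => //.
  - by move=> k; exact: normr_ge0.
  - by apply: is_cvg_geometric_series; rewrite ger0_norm ?invr_ge0// invf_lt1// ltr1n.
rewrite (_ : u = cst (u 0%N) \+ series (telescope u))%R; last first.
  by apply/funext => k; rewrite [LHS]eq_sum_telescope.
by apply: is_cvgD => //; exact: is_cvg_cst.
Qed.

Section ae_convergence.
Context d (T : measurableType d) (R : realType).
Variable mu : {measure set T -> \bar R}.
Implicit Types (D : set T) (y : nat -> T -> R).
Local Open Scope ereal_scope.

(** The weighted sum of the [4 ^ k (y_k - y_(k+1))^2] has integral at most
    [sum_k 4 ^ k / 16 ^ k], so it is finite almost everywhere; it bounds each of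
    its terms, which is the hypothesis of the previous lemma. *)
Lemma ae_cvg_sqdist D y : measurable D -> (forall k, measurable_fun D (y k)) ->
  (forall k, sqdist mu D (y k) (y k.+1) <= ((16 ^+ k)^-1)%:E) ->
  \forall s \ae mu, D s -> cvgn (y ^~ s).
Proof.
move=> mD my yc.
pose g k s := (4 ^+ k)%:E * ((y k s - y k.+1 s) ^+ 2)%:E.
have g0 k s : 0 <= g k s by rewrite /g mule_ge0// lee_fin sqr_ge0.
have mg k : measurable_fun D (g k).
  by apply: measurable_funeM; exact: measurable_sqdiff.
pose S s := \sum_(0 <= k <oo) g k s.
have S0 s : 0 <= S s by apply: nneseries_ge0.
have iS : \int[mu]_(s in D) S s < +oo.
  rewrite integral_nneseries//.
  (* 2 / 2 ^ (k + 1) = 2 ^ - k is a crude bound of 4 ^ - k. *)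
  apply: (@le_lt_trans _ _ (\sum_(0 <= k <oo) (2 / (2 ^ (k + 1))%:R)%:E)).
    apply: lee_nneseries => [k _ _|k _]; first by apply: integral_ge0 => s _; exact: g0.
    rewrite ge0_integralZl//; last 2 first.
    - exact: measurable_sqdiff.
    - by move=> s _; rewrite lee_fin sqr_ge0.
    apply: (@le_trans _ _ ((4 ^+ k)%:E * ((16 ^+ k)^-1)%:E)).
      by rewrite lee_pmul2l// ?lte_fin ?exprn_gt0//; exact: yc.
    rewrite -EFinM lee_fin (_ : 16 = 4 * 4)%R; last by lra.
    rewrite exprMn invfM mulrA divff ?expf_neq0// mul1r addn1 expnS natrM invfM.
    rewrite mulrA divff// mul1r lef_pV2 ?posrE ?exprn_gt0// ?ltr0n ?expn_gt0//.
    by rewrite natrX lerXn2r ?nnegrE//; lra.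
  by rewrite (cvg_lim _ (@cvg_geometric_eseries_half R 2 0))// ltry.
have : mu.-integrable D S.
  apply/integrableP; split; first exact: ge0_emeasurable_sum.
  by under eq_integral do rewrite gee0_abs//.
move=> /(integrable_ae mD); apply: filterS => s Sfin /Sfin sfin.
apply: (@cvg_quarter_increments _ _ (fine (S s))) => k.
rewrite -lee_fin fineK//; apply: (@le_trans _ _ (\sum_(0 <= i < k.+1) g i s)).
  by rewrite big_nat_recr//= leeDr// sume_ge0.
exact: nneseries_lim_ge.
Qed.

(** Lower semicontinuity of the distance to [h], by Fatou's lemma. *)
Lemma sqdist_ae_lim D (h z : T -> R) y (c : nat -> R) (l : R) : measurable D ->
  measurable_fun D h -> measurable_fun D z -> (forall k, measurable_fun D (y k)) ->
  (\forall s \ae mu, D s -> y k s @[k --> \oo] --> z s) ->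
  (forall k, sqdist mu D h (y k) <= (c k)%:E) -> c k @[k --> \oo] --> l ->
  sqdist mu D h z <= l%:E.
Proof.
move=> mD mh mz my yz hy cl.
pose q k s := ((h s - y k s) ^+ 2)%:E.
have mq k : measurable_fun D (q k) by exact: measurable_sqdiff.
have q0 k s : 0 <= q k s by rewrite lee_fin sqr_ge0.
rewrite /sqdist (ge0_ae_eq_integral (g := fun s => limn_einf (q ^~ s)))//.
- apply: (le_trans (fatou mu mD mq _)) => //.
  rewrite limn_einf_lim.
  have cl' : (c k)%:E @[k --> \oo] --> l%:E by apply: cvg_EFin => //; exact: nearW.
  rewrite -(cvg_lim _ cl')//; apply: lee_lim; [exact: is_cvg_einfs|by apply/cvg_ex; exists l%:E|].
  apply: nearW => k; apply: le_trans (hy k).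
  by apply: ereal_inf_lbound; exists k => /=.
- exact: measurable_sqdiff.
- apply: (emeasurable_fun_cvg (fun n s => einfs (q ^~ s) n)).
    by move=> n; exact: measurable_fun_einfs.
  by move=> s _; rewrite limn_einf_lim; exact: is_cvg_einfs.
- by move=> s _; rewrite lee_fin sqr_ge0.
- move=> s _; rewrite limn_einf_lim; apply: lime_ge; first exact: is_cvg_einfs.
  by apply: nearW => k; apply: le_ereal_inf_tmp => _ [n _ <-].
- apply: filterS yz => s yz /yz {}yz.
  apply/esym; apply: (cvg_limn_einf_sup _).1.
  apply: cvg_EFin; first exact: nearW.
  rewrite /comp /=; under eq_fun do rewrite expr2; rewrite expr2.
  by apply: cvgM; apply: cvgB => //; exact: cvg_cst.
Qed.

End ae_convergence.

(** * Classes and their representatives *)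

Section L2_representatives.
Context d (T : measurableType d) (R : realType).
Variables (mu : {measure set T -> \bar R}) (D : set T) (mD : measurable D).
Local Open Scope ereal_scope.

Lemma ge0_integral_mrestr (f : T -> \bar R) :
  measurable_fun setT f -> (forall s, 0 <= f s) ->
  \int[mrestr mu mD]_s f s = \int[mu]_(s in D) f s.
Proof.
move=> mf f0.
rewrite (@ge0_negligible_integral _ _ _ _ setT (~` D))//; last 2 first.
- exact: measurableC.
- by rewrite /= /mrestr setICl measure0.
rewrite setTD setCK; apply: eq_measure_integral => A mA AD.
by rewrite /= /mrestr setIidl.
Qed.

Lemma ae_mrestr (P : T -> Prop) :
  (\forall s \ae mrestr mu mD, P s) -> \forall s \ae mu, D s -> P s.
Proof.
move=> [N [mN N0 PN]]; exists (N `&` D); split => //; first exact: measurableI.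
by move=> s /= /not_implyP[Ds nPs]; split => //; exact: PN.
Qed.

Lemma finite_norm2E (f : T -> R) : measurable_fun setT f ->
  finite_norm (mrestr mu mD) 2%:E f <-> sqdist mu D (cst 0%R) f < +oo.
Proof.
move=> mf.
have E : 'N[mrestr mu mD]_2[EFin \o f] `^ 2 = sqdist mu D (cst 0%R) f.
  rewrite /sqdist poweR_Lnorm// -ge0_integral_mrestr.
  - by apply: eq_integral => s _ /=; rewrite powR_mulrn// real_normK ?num_real// sub0r sqrrN.
  - apply: measurable_sqdiff => //.
  - by move=> s; rewrite lee_fin sqr_ge0.
rewrite /finite_norm -E; split; first exact: poweR_lty.
exact: lty_poweRy.
Qed.

Lemma Lspace2_measurable (x : LspaceType2 (mrestr mu mD)) :
  measurable_fun setT (x : T -> R).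
Proof. exact: (measurable_funP (repr (LebesgueSpace.sort x))). Qed.

Lemma Lspace2_sqdist0 (x : LspaceType2 (mrestr mu mD)) :
  sqdist mu D (cst 0%R) x < +oo.
Proof.
by apply/finite_norm2E; [exact: Lspace2_measurable|exact: Lebesgue_finite].
Qed.

(** The representative of the class of [f] is some other function; it can be
    compared with [f] only up to a null set. *)
Lemma Lspace2_class (f : T -> R) : measurable_fun setT f ->
  sqdist mu D (cst 0%R) f < +oo ->
  exists x : LspaceType2 (mrestr mu mD), (x : T -> R) = f %[ae mu in D].
Proof.
move=> mf ffin.
pose F : {mfun T >-> measurableTypeR R} :=
  HB.pack f (@isMeasurableFun.Build _ _ T (measurableTypeR R) f mf).
pose q : {mfun_ (mrestr mu mD), T >-> measurableTypeR R} :=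
  (\pi_{mfun_ (mrestr mu mD), T >-> measurableTypeR R} F)%qT.
have qF : (q : T -> R) = f %[ae mrestr mu mD].
  have : (\pi_{mfun_ (mrestr mu mD), T >-> measurableTypeR R} (repr q) =
          \pi_{mfun_ (mrestr mu mD), T >-> measurableTypeR R} F)%qT.
    by rewrite reprK.
  by move=> /eqP; rewrite eqmodE => /asboolP.
have qF' : (q : T -> R) = f %[ae mu in D].
  by apply: ae_mrestr; apply: filterS qF => s; exact.
have mq : measurable_fun setT (q : T -> R) by exact: (measurable_funP (repr q)).
have fq : finite_norm (mrestr mu mD) 2%:E (q : T -> R).
  apply/finite_norm2E => //.
  by rewrite (sqdist_ae_eq _ _ _ _ qF')//; exact: measurable_funTS.
by exists (LebesgueSpace.Pack
  (LebesgueSpace.Class (isFinLebesgue.Build _ _ _ _ _ _ _ fq))).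
Qed.

End L2_representatives.

(** * Minimizing the worst squared error *)

Section worst_error.
Context d (T : measurableType d) (R : realType).
Variable mu : {measure set T -> \bar R}.
Variables (I : Type) (P : set I) (D : I -> set T) (K : I -> T -> R) (top : I).
Hypotheses (Ptop : P top) (mD : forall i, P i -> measurable (D i)).
Hypothesis Dtop : forall i, P i -> D i `<=` D top.
Hypothesis mK : forall i, P i -> measurable_fun (D i) (K i).
Local Open Scope ereal_scope.

(** The square of the functional to be minimized.  Squares make both midpoint
    convexity and Fatou's lemma directly applicable. *)
Definition worst (x : T -> R) := ereal_sup [set sqdist mu (D i) (K i) x | i in P].

Definition square_summable (x : T -> R) :=
  measurable_fun setT x /\ sqdist mu (D top) (cst 0%R) x < +oo.

Hypothesis K_bounded : worst (cst 0%R) < +oo.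

Lemma sqdist_le_worst i x : P i -> sqdist mu (D i) (K i) x <= worst x.
Proof. by move=> Pi; apply: ereal_sup_ubound; exists i. Qed.

Lemma worst_ge0 x : 0 <= worst x.
Proof. by apply: le_trans (sqdist_le_worst x Ptop); exact: sqdist_ge0. Qed.

Lemma worst_fin x : square_summable x -> worst x < +oo.
Proof.
move=> [mx xfin].
apply: (@le_lt_trans _ _ (2%:E * (worst (cst 0%R) + sqdist mu (D top) (cst 0%R) x))).
  apply: ge_ereal_sup => _ [i Pi <-].
  apply: (le_trans (@sqdist_triangle _ _ _ mu _ (cst 0%R) _ _ (mD Pi) _ _ _)) => //.
  - exact: mK.
  - exact: measurable_funTS.
  rewrite lee_pmul2l// leeD//.
    rewrite (_ : sqdist mu _ (cst 0%R) _ = sqdist mu (D i) (K i) (cst 0%R)).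
      exact: sqdist_le_worst.
    by apply: eq_integral => s _ /=; rewrite sub0r subr0 sqrrN.
  by apply: sqdist_subset => //; [exact: mD|exact: mD|exact: Dtop|exact: measurable_funTS].
by rewrite lte_mul_pinfty// lte_add_pinfty.
Qed.

(** Coercivity: the index [top] controls the distance to [K top] on the whole
    domain. *)
Lemma square_summable_of_worst x :
  measurable_fun setT x -> worst x < +oo -> square_summable x.
Proof.
move=> mx xfin; split => //.
have mt := mD Ptop.
apply: (le_lt_trans (@sqdist_triangle _ _ _ mu _ (K top) _ _ mt _ _ _)) => //.
- exact: mK.
- exact: measurable_funTS.
rewrite lte_mul_pinfty// lte_add_pinfty//.
- by apply: le_lt_trans K_bounded; exact: sqdist_le_worst.
- by apply: le_lt_trans xfin; exact: sqdist_le_worst.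
Qed.

Lemma worst_ae_eq x y : measurable_fun setT x -> measurable_fun setT y ->
  x = y %[ae mu in D top] -> worst x = worst y.
Proof.
move=> mx my xy; congr ereal_sup; apply: eq_imagel => i Pi.
apply: sqdist_ae_eq.
- exact: mD.
- exact: mK.
- exact: measurable_funTS.
- exact: measurable_funTS.
- by apply: filterS xy => s xys /(Dtop Pi); exact: xys.
Qed.

Lemma worst_mid_le x y c : measurable_fun setT x -> measurable_fun setT y ->
  worst x <= c -> worst y <= c -> worst (midfun x y) <= c.
Proof.
move=> mx my xc yc; apply: ge_ereal_sup => _ [i Pi <-].
apply: sqdist_mid_le.
- exact: mD.
- exact: mK.
- exact: measurable_funTS.
- exact: measurable_funTS.
- exact: le_trans (sqdist_le_worst x Pi) xc.
- exact: le_trans (sqdist_le_worst y Pi) yc.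
Qed.

(** The distances between consecutive terms of the minimizing sequence are made
    small by means of the centre [K top], the distance to which is bounded by
    [worst]. *)
Lemma worst_attains_min :
  exists2 x, square_summable x & forall y, square_summable y -> worst x <= worst y.
Proof.
have mt := mD Ptop.
have sq0 : square_summable (cst 0%R) by apply: square_summable_of_worst.
pose m := ereal_inf [set worst x | x in square_summable].
have m0 : 0 <= m by apply: le_ereal_inf_tmp => _ [x _ <-]; exact: worst_ge0.
have mfin : m \is a fin_num.
  rewrite ge0_fin_numE//; apply: le_lt_trans K_bounded.
  by apply: ereal_inf_lbound; exists (cst 0%R).
pose c n : R := (fine m + n.+1%:R^-1)%R.
have cm : c n @[n --> \oo] --> fine m.
  rewrite -[X in _ --> X]addr0; apply: cvgD; first exact: cvg_cst.
  exact: cvg_harmonic.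
pose C n := [set x | measurable_fun setT x /\ worst x <= (c n)%:E].
pose N x : R := fine (sqdist mu (D top) (K top) x).
have Cfin n x : C n x -> sqdist mu (D top) (K top) x <= (c n)%:E.
  by move=> [_]; apply: le_trans; exact: sqdist_le_worst.
have NE n x : C n x -> (N x)%:E = sqdist mu (D top) (K top) x.
  move=> Cx; rewrite fineK// ge0_fin_numE ?sqdist_ge0//.
  by rewrite (le_lt_trans (Cfin _ _ Cx))// ltry.
have Cmid n x y : C n x -> C n y -> C n (midfun x y).
  move=> [mx xc] [my yc]; split; first exact: measurable_midfun.
  exact: worst_mid_le.
have eps0 k : (0 < (2 * 16 ^+ k)^-1 :> R)%R by rewrite invr_gt0 mulr_gt0// exprn_gt0.
have [| |x Cx|y yP] := @nested_midpoint_min R _ C N (@midfun _ _ _) (c 0%N)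
    (fun k => ((2 * 16 ^+ k)^-1)%R) _ _ Cmid _ eps0.
- move=> n.
  have : m < (c n)%:E by rewrite -(fineK mfin) lte_fin ltrDl invr_gt0.
  move=> /ereal_inf_lt[_ [x [mx _] <-] xc].
  by exists x; split => //; exact: ltW.
- move=> k n kn x [mx xc]; split => //; apply: (le_trans xc).
  by rewrite lee_fin lerD2l lef_pV2 ?posrE// ler_nat.
- by rewrite -!lee_fin (NE _ _ Cx) sqdist_ge0/= (Cfin _ _ Cx).
have my k : measurable_fun setT (y k) by have [[]] := yP k.
(* Half of the squared distance is the midpoint defect of N, whence the factor
   2 in the tolerance. *)
have yinc k : sqdist mu (D top) (y k) (y k.+1) <= ((16 ^+ k)^-1)%:E.
  have [Cy Ny] := yP k; have [CyS _] := yP k.+1.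
  have Cy0 j : C j (y j) -> C 0%N (y j).
    move=> [? yc]; split => //; apply: le_trans yc _.
    by rewrite lee_fin lerD2l lef_pV2 ?posrE// ler_nat.
  have := @sqdist_parallelogram _ _ _ mu _ _ _ _ mt (mK Ptop)
    (measurable_funTS (my k)) (measurable_funTS (my k.+1)).
  rewrite -(NE _ _ Cy) -(NE _ _ CyS) -(NE _ _ (Cmid _ _ _ (Cy0 _ Cy) (Cy0 _ CyS))).
  have : sqdist mu (D top) (y k) (y k.+1) \is a fin_num.
    rewrite ge0_fin_numE ?sqdist_ge0//.
    apply: (le_lt_trans (@sqdist_triangle _ _ _ mu _ (K top) _ _ mt _ _ _)) => //.
    + exact: mK.
    + exact: measurable_funTS.
    + exact: measurable_funTS.
    by rewrite -(NE _ _ Cy) -(NE _ _ CyS) -EFinD -EFinM ltry.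
  move=> /fineK <-; set q := fine _; rewrite -EFinM -!EFinD -EFinM => -[qE].
  rewrite lee_fin; move: Ny; rewrite invfM.
  set e := ((16 ^+ k)^-1)%R; lra.
have yae := ae_cvg_sqdist mt (fun k => measurable_funTS (my k)) yinc.
(* The limsup gives a limit that is measurable on all of T. *)
pose z s := fine (limn_esup (fun k => (y k s)%:E)).
have mz : measurable_fun setT z.
  apply: (@measurableT_comp _ _ _ _ _ _ fine); first exact: fine_measurable.
  by apply: measurable_fun_limn_esup => k; apply/measurable_EFinP.
have yz : \forall s \ae mu, D top s -> y k s @[k --> \oo] --> z s.
  apply: filterS yae => s ys /ys cy.
  have cyE : (y k s)%:E @[k --> \oo] --> (limn (y ^~ s))%:E.
    by apply: cvg_EFin => //; exact: nearW.
  by rewrite /z (cvg_limn_einf_sup cyE).2.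
have zm : worst z <= m.
  apply: ge_ereal_sup => _ [i Pi <-].
  rewrite -(fineK mfin); apply: (@sqdist_ae_lim _ _ _ _ _ _ _ y c) => //.
  - exact: mD.
  - exact: mK.
  - exact: measurable_funTS.
  - by move=> k; exact: measurable_funTS.
  - by apply: filterS yz => s ys /(Dtop Pi); exact: ys.
  - by move=> k; apply: le_trans (sqdist_le_worst _ Pi) _; have [[]] := yP k.
exists z.
  by apply: square_summable_of_worst => //; rewrite (le_lt_trans zm)// -ge0_fin_numE.
by move=> x sx; apply: (le_trans zm); apply: ereal_inf_lbound; exists x.
Qed.

End worst_error.

(** * Existence of the minimizer *)

Lemma ereal_sup_sqrte (R : realType) (I : Type) (A : set I) (f : I -> \bar R) :
  A !=set0 -> (forall i, 0 <= f i)%E ->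
  ereal_sup [set sqrte (f i) | i in A] = sqrte (ereal_sup [set f i | i in A]).
Proof.
move=> [i0 Ai0] f0.
have fsup i : A i -> (f i <= ereal_sup [set f i | i in A])%E.
  by move=> Ai; apply: ereal_sup_ubound; exists i.
have gsup i : A i -> (sqrte (f i) <= ereal_sup [set sqrte (f i) | i in A])%E.
  by move=> Ai; apply: ereal_sup_ubound; exists i.
have sup0 : (0 <= ereal_sup [set f i | i in A])%E.
  exact: le_trans (f0 i0) (fsup _ Ai0).
have gsup0 : (0 <= ereal_sup [set sqrte (f i) | i in A])%E.
  by apply: le_trans (gsup _ Ai0); exact: sqrte_ge0.
apply/le_anti/andP; split.
  by apply: ge_ereal_sup => _ [i Ai <-]; rewrite lee_sqrt// fsup.
rewrite -[leRHS]gee0_abs// -sqrte_sqr lee_sqrt ?sqre_ge0//.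
apply: ge_ereal_sup => _ [i Ai <-].
by rewrite -(sqr_sqrte (f0 i)) lee_sqr// ?sqrte_ge0 ?gsup.
Qed.

Theorem theorem1 (R : realType) (K : R -> R -> R)
    (K_L2 : forall t : R, t \in `[0, 1] -> square_integrable 0 t (K t))
    (K_sup : (ereal_sup [set \int[leb R]_(s in `[0%R, t]) ((K t s) ^+ 2)%:E
                        | t in `[0%R, 1%R]] < +oo)%E) :
  (forall x : L2 (0 : R) 1, sup_dist K x \is a fin_num) /\
  exists xstar : L2 (0 : R) 1,
    sup_dist K xstar = ereal_inf [set sup_dist K x | x in [set: L2 (0 : R) 1]].
Proof.
pose D (t : R) : set R := `[0%R, t]%classic.
pose P : set R := `[0%R, 1%R]%classic.
have P1 : P 1 by rewrite /P /= in_itv/= ler01 lexx.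
have mD t : P t -> (wlength (@idfun R))^*%mu.-cara.-measurable (D t).
  by move=> _; exact: measurable_leb_itv.
have D1 t : P t -> D t `<=` D 1.
  rewrite /P /D /= in_itv/= => /andP[_ t1] s /=; rewrite !in_itv/= => /andP[-> /=].
  by move=> st; exact: le_trans st t1.
have mK t : P t -> @measurable_fun _ _
    (caratheodory_type ((wlength (@idfun R))^*%mu)) (measurableTypeR R) (D t) (K t).
  move=> Pt; have /andP[+ _] := K_L2 t Pt; rewrite inE/= => mKt.
  exact: (measurable_restrictT _ (mD t Pt)).2 mKt.
have K0 : (worst (leb R) P D K (cst 0%R) < +oo)%E.
  apply: le_lt_trans K_sup; rewrite le_eqVlt; apply/orP; left; apply/eqP; congr ereal_sup.
  apply: eq_imagel => t _; apply: eq_integral => s _.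
  by rewrite /= subr0.
have supE (x : R -> R) : ereal_sup
    [set sqrte (\int[leb R]_(s in `[0%R, t]) ((K t s - x s) ^+ 2)%:E)%E
            | t in `[0%R, 1%R]] = sqrte (worst (leb R) P D K x).
  by apply: ereal_sup_sqrte; [exists 1|move=> t; exact: sqdist_ge0].
have w0 x : (0 <= worst (leb R) P D K x)%E by exact: worst_ge0 P1 x.
have sq (x : L2 (0 : R) 1) : square_summable (leb R) D 1 x.
  split; [exact: Lspace2_measurable|exact: Lspace2_sqdist0].
split=> [x|].
  rewrite /sup_dist supE sqrte_fin_num// ge0_fin_numE//.
  exact: (worst_fin P1 mD D1 mK K0 (sq x)).
have [z [mz zfin] zmin] := worst_attains_min P1 mD D1 mK K0.
have [x xz] := Lspace2_class (measurable_leb_itv `[0, 1]) mz zfin.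
exists x; apply/le_anti/andP; split; last first.
  by apply: ereal_inf_lbound; exists x.
apply: le_ereal_inf_tmp => _ [y _ <-].
rewrite /sup_dist !supE lee_sqrt//.
apply: le_trans (zmin _ (sq y)).
rewrite (worst_ae_eq mD D1 mK _ mz xz)//; exact: Lspace2_measurable.
Qed.
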